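(* Let $q$ be any prime power and let $s,t\in\mathbb F_q$ with $t\neq0$ and $1+s+t\neq0$. Let $f_{s,t}=\frac{X^3+sX+t}{X(X-1)}$ and $G_{s,t}(X)=X^4-2X^3-sX^2-2tX+t$. The following are equivalent: (i) $|f_{s,t}^{-1}(\alpha)|=2$ for some $\alpha\in\mathbb F_q$; (ii) $G_{s,t}$ has a root $x\in\mathbb F_q$ with $x^3\neq -t$; (iii) there exist $a,b\in\mathbb F_q$ with $a\neq b$ such that $t=-a^2b$ and $s=-2a-b+a^2+2ab$.
   Context: $\mathbb F_q$ is the field with $q$ elements. A rational function in $\mathbb F_q(X)$ induces a map $\mathbb P^1(\mathbb F_q)=\mathbb F_q\cup\{\infty\}\to\mathbb P^1(\mathbb F_q)$, and $f^{-1}(\alpha)$ denotes the preimage of $\alpha$ in $\mathbb P^1(\mathbb F_q)$. *)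

(* Defs.v *)
From HB Require Import structures.
From mathcomp Require Import all_boot all_order all_algebra.

Set Implicit Arguments.
Unset Strict Implicit.
Unset Printing Implicit Defensive.

Import GRing.Theory.
Local Open Scope ring_scope.

Notation "p %:F" := (@FracField.tofrac _ p) : ring_scope.

Section RationalMap.

Variable F : fieldType.
Implicit Types (f : {fraction {poly F}}) (P : option F).

Definition rat_num f : {poly F} :=
  let: (n, d) := frac (repr f) in n %/ gcdp n d.

Definition rat_den f : {poly F} :=
  let: (n, d) := frac (repr f) in d %/ gcdp n d.

(* The map induced by [f] on the projective line P^1(F) = F \cup {oo},        *)
(* encoded as [option F] with [None] for oo.  The numerator and denominator   *)
(* above are coprime, and unique up to a common nonzero constant, so they do  *)
(* not vanish simultaneously and only their ratio matters.  At oo the value   *)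
(* is the ratio of the coefficients of degree max(deg num, deg den); recall   *)
(* that [size p] is 1 + deg p.                                                *)
Definition rat_map f P : option F :=
  if P is Some x then
    if (rat_den f).[x] == 0 then None
    else Some ((rat_num f).[x] / (rat_den f).[x])
  else
    if (size (rat_den f) < size (rat_num f))%N then None
    else Some ((rat_num f)`_(size (rat_den f)).-1 / lead_coef (rat_den f)).

End RationalMap.

Definition rat_fiber (F : finFieldType) (f : {fraction {poly F}})
  (P : option F) : {set option F} := [set Q | rat_map f Q == P].

Definition f_st (F : fieldType) (s t : F) : {fraction {poly F}} :=
  ('X^3 + s *: 'X + t%:P)%:F / ('X * ('X - 1))%:F.

Definition G_st (F : fieldType) (s t : F) : {poly F} :=
  'X^4 - 2%:R *: 'X^3 - s *: 'X^2 - (2%:R * t) *: 'X + t%:P.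

(* Main.v *)
(* The fiber of f_{s,t} over alpha is the set of roots in F of the cubic
   X^3 - alpha X^2 + (s + alpha) X + t.  If this cubic has two roots in F, then
   its third root is in F as well, so the fiber has two elements iff the cubic is
   (X - a)^2 (X - b) with a != b; comparing coefficients and eliminating
   alpha = 2 a + b gives (iii).  Eliminating b = - t / a^2 from (iii) instead
   leaves G_{s,t}(a) = 0, and a != b becomes a^3 != - t. *)

Require Import Defs.
From mathcomp Require Import all_boot all_order all_algebra.
From mathcomp Require Import generic_quotient ring.

Import GRing.Theory.
Local Open Scope ring_scope.

(** Clearing the denominator avoids an inverse in the quotient: what is left is an equality of two
    classes, checked by cross-multiplying representatives. *)
Lemma tofrac_repr (R : idomainType) (f : {fraction R}) :
  f = FracField.tofrac (repr f).1 / FracField.tofrac (repr f).2.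
Proof.
have d0 := denom_ratioP (repr f).
suff -> : FracField.tofrac (repr f).1 = f * FracField.tofrac (repr f).2.
  by rewrite mulfK // tofrac_eq0.
rewrite -{2}[f]reprK; unlock FracField.tofrac.
rewrite -[RHS]FracField.pi_mul; apply/eqmodP.
by rewrite /= /FracField.equivf !numden_Ratio ?mulr1 ?mul1r ?oner_eq0 // mulrC.
Qed.

Section RatMap.

Variable F : fieldType.
Implicit Types (f : {fraction {poly F}}) (n d : {poly F}).

(** By Gauss's lemma [d] and [d'] divide each other, so they differ by a constant; cancelling [d]
    carries that constant over to the numerators. *)
Lemma coprime_frac_scale n d n' d' :
    coprimep n d -> coprimep n' d' -> d != 0 -> d' != 0 -> n * d' = n' * d ->
  exists2 c : F, c != 0 & n' = c *: n /\ d' = c *: d.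
Proof.
move=> cop cop' d0 d0' E.
have dvd1 : d %| d'.
  have : d %| n * d' by rewrite E dvdp_mull.
  by rewrite Gauss_dvdpr // coprimep_sym.
have dvd2 : d' %| d.
  have : d' %| n' * d by rewrite -E dvdp_mull.
  by rewrite Gauss_dvdpr // coprimep_sym.
have /eqpf_eq[c c0 Ed'] : d' %= d by rewrite /eqp dvd2.
exists c; rewrite //; split=> //.
by apply: (mulIf d0); rewrite -E Ed' -!scalerAl -scalerAr.
Qed.

Lemma rat_den_neq0 f : rat_den f != 0.
Proof.
rewrite /rat_den; have := denom_ratioP (repr f).
case: (frac _) => n d /= d0.
by rewrite dvdp_div_eq0 ?dvdp_gcdr.
Qed.

Lemma coprime_rat_num_den f : coprimep (rat_num f) (rat_den f).
Proof.
rewrite /rat_num /rat_den; have := denom_ratioP (repr f).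
case: (frac _) => n d /= d0.
by rewrite coprimep_div_gcd // d0 orbT.
Qed.

Lemma rat_num_denE f : f = (rat_num f)%:F / (rat_den f)%:F.
Proof.
rewrite {1}(tofrac_repr _ f) /rat_num /rat_den.
have := denom_ratioP (repr f).
case: (frac _) => n d /= d0.
set g := gcdp n d; have g0 : g != 0 by rewrite gcdp_eq0 negb_and d0 orbT.
have d1 : d %/ g != 0 by rewrite dvdp_div_eq0 ?dvdp_gcdr.
apply/eqP; rewrite eqr_div ?tofrac_eq0 // -!tofracM tofrac_eq.
by rewrite divp_mulA ?dvdp_gcdr // divp_mulAC ?dvdp_gcdl.
Qed.

(** Frees [rat_map] from the representative picked by [repr]: another reduced form differs by a
    nonzero constant, which preserves sizes and cancels in the ratios. *)
Lemma rat_map_div n d (P : option F) : coprimep n d -> d != 0 ->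
  rat_map (n%:F / d%:F) P =
    if P is Some x then if d.[x] == 0 then None else Some (n.[x] / d.[x])
    else if (size d < size n)%N then None
    else Some (n`_(size d).-1 / lead_coef d).
Proof.
move=> cop d0; set f := n%:F / d%:F.
have E : n * rat_den f = rat_num f * d.
  apply/eqP; rewrite -tofrac_eq !tofracM -eqr_div ?tofrac_eq0 ?rat_den_neq0 //.
  by rewrite -rat_num_denE.
have [c c0 [En Ed]] :=
  coprime_frac_scale _ _ _ _ cop (coprime_rat_num_den f) d0 (rat_den_neq0 f) E.
rewrite /rat_map En Ed; case: P => [x|].
  by rewrite !hornerZ mulf_eq0 (negPf c0) /= -mulf_div divff ?mul1r.
by rewrite !size_scale // lead_coefZ coefZ -mulf_div divff ?mul1r.
Qed.

End RatMap.

Section Fiber.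

Variables (F : finFieldType) (s t : F).
Hypotheses (ht : t != 0) (hst : 1 + s + t != 0).

(* The hypotheses say that the numerator does not vanish at 0 and 1, so these
   points and oo are poles; the cubic has no root among them either. *)
Lemma f_st_fiberE (alpha : F) :
  rat_fiber (f_st s t) (Some alpha) =
  Some @: [set x | x ^+ 3 - alpha * x ^+ 2 + (s + alpha) * x + t == 0].
Proof.
have d0 : 'X * ('X - 1) != 0 :> {poly F}.
  by rewrite mulf_neq0 ?polyX_eq0 // -[1]/(1%:P) polyXsubC_eq0.
have cop : coprimep ('X^3 + s *: 'X + t%:P) ('X * ('X - 1)).
  rewrite coprimepMr coprimepX -[1]/(1%:P) coprimep_XsubC /root !hornerE.
  rewrite expr1n ?expr0n /= ?mulr0 ?mulr1 ?addr0 ?add0r ht /=.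
  by rewrite hst.
have sz : size ('X * ('X - 1) : {poly F}) = 3.
  by rewrite mulrC -[1]/(1%:P) size_mulX ?size_XsubC // polyXsubC_eq0.
have sn : size ('X^3 + s *: 'X + t%:P : {poly F}) = 4.
  rewrite -addrA size_polyDl size_polyXn //.
  rewrite (leq_ltn_trans (size_polyD _ _)) // gtn_max.
  rewrite (leq_ltn_trans (size_scale_leq _ _)) ?size_polyX //.
  by rewrite (leq_ltn_trans (size_polyC_leq1 _)).
apply/setP=> [[x|]]; rewrite inE rat_map_div //; last first.
  by rewrite sz sn; apply/esym/negbTE/imsetP; case.
rewrite mem_imset ?inE; last exact: Some_inj.
rewrite !hornerE mulf_eq0 subr_eq0; case: (eqVneq x 0) => [->|x0] /=.
  by rewrite expr0n /= !mulr0 subr0 !add0r (negPf ht).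
(* At 1 the terms in [alpha] cancel and the cubic takes the value [1 + s + t]. *)
case: (eqVneq x 1) => [->|x1] /=.
  apply/esym/negbTE; apply: contra hst => /eqP E; apply/eqP; rewrite -[RHS]E.
  by ring.
have d1 : x * (x - 1) != 0 by rewrite mulf_neq0 // subr_eq0.
rewrite (inj_eq Some_inj) (can2_eq (divfK d1) (mulfK d1)) -subr_eq0.
by congr (_ == 0); ring.
Qed.

End Fiber.

(** Vieta's formulas, with [c] forced by the sum of the roots: subtracting the two equations and
    cancelling [a - b] gives [e2], and the equation at [a] then gives [e3]. *)
Lemma cubic_two_roots (F : fieldType) (a b alpha e2 e3 : F) : a != b ->
    a ^+ 3 - alpha * a ^+ 2 + e2 * a - e3 = 0 ->
    b ^+ 3 - alpha * b ^+ 2 + e2 * b - e3 = 0 ->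
  let c := alpha - a - b in
  [/\ e2 = a * b + a * c + b * c, e3 = a * b * c
    & c ^+ 3 - alpha * c ^+ 2 + e2 * c - e3 = 0].
Proof.
move=> ab pa pb c.
have E2 : e2 = a * b + a * c + b * c.
  apply/eqP; rewrite -subr_eq0.
  have /eqP : (a - b) * (e2 - (a * b + a * c + b * c)) = 0.
    transitivity ((a ^+ 3 - alpha * a ^+ 2 + e2 * a - e3)
                  - (b ^+ 3 - alpha * b ^+ 2 + e2 * b - e3)).
      by rewrite /c; ring.
    by rewrite pa pb subrr.
  by rewrite mulf_eq0 !subr_eq0 (negPf ab).
have E3 : e3 = a * b * c.
  apply/eqP; rewrite -subr_eq0 -oppr_eq0; apply/eqP.
  by rewrite -[RHS]pa E2 /c; ring.
by split=> //; rewrite E2 E3 /c; ring.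
Qed.

Theorem theorem6p1 (F : finFieldType) (s t : F)
    (ht : t != 0) (hst : 1 + s + t != 0) :
  [<-> exists alpha : F, #|rat_fiber (f_st s t) (Some alpha)| = 2%N;
       exists x : F, root (G_st s t) x /\ x ^+ 3 != - t;
       exists a b : F, [/\ a != b, t = - (a ^+ 2 * b)
         & s = - 2%:R * a - b + a ^+ 2 + 2%:R * a * b]].
Proof.
have rootG x : root (G_st s t) x =
    (x ^+ 4 - 2%:R * x ^+ 3 - s * x ^+ 2 - 2%:R * t * x + t == 0).
  by rewrite /root /G_st !hornerE.
tfae.
- case=> alpha; rewrite f_st_fiberE // card_imset; last exact: Some_inj.
  move/eqP/cards2P=> [x [y [xy Exy]]].
  have rootE z : (z ^+ 3 - alpha * z ^+ 2 + (s + alpha) * z - - t == 0)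
      = (z == x) || (z == y).
    by have := in_set2 z x y; rewrite -Exy inE opprK => ->.
  have rx := rootE x; have ry := rootE y.
  rewrite !eqxx orbT in rx ry; move/eqP: rx => rx; move/eqP: ry => ry.
  have [E2 E3 /eqP] := cubic_two_roots _ _ _ _ _ _ xy rx ry.
  set c := alpha - x - y in E2 E3 *.
  have Ea : alpha = x + y + c by rewrite /c; ring.
  (* Here [a] is the double root and [b] the simple one, so that both positions of the third root
     are treated at once. *)
  have key a b : a != b -> alpha = a + a + b ->
      s + alpha = a * a + a * b + a * b -> - t = a * a * b ->
      exists x0, root (G_st s t) x0 /\ x0 ^+ 3 != - t.
    move=> ab al E E'; exists a.
    have Es : s = a * a + a * b + a * b - (a + a + b) by rewrite -E -al addrK.
    have Et : t = - (a * a * b) by rewrite -E' opprK.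
    rewrite rootG; split; first by apply/eqP; rewrite Es Et; ring.
    have a0 : a != 0 by apply: contra ht => /eqP a0; rewrite Et a0 !mul0r oppr0.
    rewrite E' -subr_eq0.
    have -> : a ^+ 3 - a * a * b = a * a * (a - b) by ring.
    by rewrite !mulf_neq0 // subr_eq0.
  (* The third root [c] also lies in the two-element root set, so it repeats [x] or [y]. *)
  rewrite rootE => /orP[] /eqP cE; rewrite cE in E2 E3 Ea.
  + by apply: (key x y); rewrite // ?E2 ?E3 ?Ea; ring.
  + by apply: (key y x); rewrite ?(eq_sym y) // ?E2 ?E3 ?Ea; ring.
- case=> x []; rewrite rootG => /eqP Gx xt.
  have x0 : x != 0.
    apply: contra ht => /eqP x0; apply/eqP; rewrite -[RHS]Gx x0; ring.
  (* The second witness is forced by [t = - (a ^+ 2 * b)] with [a = x]; if it were equal to [x],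
     then [x ^+ 3 = - t]. *)
  exists x, (- t / x ^+ 2); split.
  + apply: contra xt => /eqP E; apply/eqP; rewrite exprS {1}E divfK //.
    by rewrite expf_neq0.
  + by field.
  + apply/eqP; rewrite -subr_eq0; apply/eqP.
    (* The defect in the formula for [s] is [G_st s t] at [x], divided by [- x ^+ 2]. *)
    have -> : s - (- 2%:R * x - - t / x ^+ 2 + x ^+ 2 + 2%:R * x * (- t / x ^+ 2))
      = - (x ^+ 4 - 2%:R * x ^+ 3 - s * x ^+ 2 - 2%:R * t * x + t) / x ^+ 2 by field.
    by rewrite Gx oppr0 mul0r.
- case=> a [b [ab Et Es]]; exists (2%:R * a + b).
  rewrite f_st_fiberE // card_imset; last exact: Some_inj.
  apply/eqP/cards2P; exists a, b; split=> //; apply/setP=> x; rewrite in_set2 inE.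
  have -> : x ^+ 3 - (2%:R * a + b) * x ^+ 2 + (s + (2%:R * a + b)) * x + t
    = (x - a) ^+ 2 * (x - b) by rewrite Es Et; ring.
  by rewrite mulf_eq0 sqrf_eq0 !subr_eq0.
Qed.
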